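(* Assume that $f$ is level bounded on $\Omega$ (i.e. $\{x\in\Omega: f(x)\le\alpha\}$ is bounded for every $\alpha\in\mathbb{R}$) and that the parameters of the extrapolated hard thresholding algorithm (described in the context) satisfy $\gamma>\frac1h+(2\beta+h)L_f$. Let $\{x^k\}$ be a sequence generated by this algorithm with $\epsilon=0$. Then: (i) there exists $M>0$ such that $\|x^k\|\le M$ for all $k\in\mathbb{N}$, and $\sum_{k=0}^{\infty}\|x^{k+1}-x^k\|^2<+\infty$; (ii) any accumulation point of $\{x^k\}$ is a local minimizer of the problem $\min_{x\in\Omega}F(x)$.
   Context: Problem: minimize $F(x)=f(x)+\lambda_1\|x_+\|_0+\lambda_2\|x_-\|_0$ over $x\in\Omega$, where $\lambda_1>0$, $\lambda_2\ge 0$, $f:\mathbb{R}^n\to\mathbb{R}$ is convex and differentiable with $L_f$-Lipschitz continuous gradient, $\|x_+\|_0$ (resp. $\|x_-\|_0$) is the number of indices $i$ with $x_i>0$ (resp. $x_i<0$), and $\Omega=\{x\in\mathbb{R}^n: l_i\le x_i\le u_i,\ i=1,\dots,n\}$ with $-\infty\le l_i\le 0\le u_i\le+\infty$, $l_i<u_i$. $\|\cdot\|$ is the Euclidean norm, $\|\cdot\|_1$ the $\ell_1$ norm, $\mathbb{N}=\{0,1,2,\dots\}$. A local minimizer is a point $x^*\in\Omega$ such that for some $\delta>0$, $F(x^* )\le F(x)$ for all $x\in\Omega$ with $\|x-x^*\|\le\delta$. Extrapolated hard thresholding algorithm: the parameters are $\epsilon\ge 0$, $\beta\ge 0$, $h>0$,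 $\gamma>0$ with $\gamma\ge \frac1h+(2\beta+h)L_f$; the initial points are $x^{-1}=x^0\in\Omega$. For $k=0,1,2,\dots$ (run indefinitely) compute $$v^k=\frac{1}{h(1+h\gamma)}(x^k-x^{k-1})-\frac{\beta}{1+h\gamma}\big(\nabla f(x^k)-\nabla f(x^{k-1})\big),\qquad z^k=v^k-\frac{h}{1+h\gamma}\nabla f(x^k),$$ and choose any $$x^{k+1}\in x^k+h\cdot\arg\min_{y\in\Omega^k}Q(x^k,z^k,y),$$ where $\Omega^k=\{y\in\mathbb{R}^n: \frac{l_i-x^k_i}{h}\le y_i\le\frac{u_i-x^k_i}{h},\ i=1,\dots,n\}$ and $$Q(x,z,y)=\frac{h\epsilon}{1+h\gamma}\|y\|_1+\frac{\lambda_1}{1+h\gamma}\|(x+hy)_+\|_0+\frac{\lambda_2}{1+h\gamma}\|(x+hy)_-\|_0+\frac12\|y-z\|^2 .$$ *)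

(* Defs.v *)
From HB Require Import structures.
From mathcomp Require Import all_boot all_order all_algebra.
From mathcomp Require Import all_classical all_reals all_analysis.

Set Implicit Arguments.
Unset Strict Implicit.
Unset Printing Implicit Defensive.

Import Order.TTheory GRing.Theory Num.Theory.
Import numFieldNormedType.Exports.

Local Open Scope classical_set_scope.
Local Open Scope ring_scope.

(* The library norm `|x| on 'rV[R]_n is the sup norm, so the Euclidean norm is
   introduced separately. The two are equivalent: the library's topological
   notions on 'rV[R]_n (differentiable, cluster, bounded_set) are the usual
   ones of R^n. *)
Definition norm2 (R : realType) (n : nat) (x : 'rV[R]_n) : R :=
  Num.sqrt (\sum_(i < n) x 0 i ^+ 2).

Definition norm1 (R : realType) (n : nat) (x : 'rV[R]_n) : R :=
  \sum_(i < n) `|x 0 i|.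

(* ||x_+||_0 *)
Definition pos_count (R : realType) (n : nat) (x : 'rV[R]_n) : nat :=
  #|[pred i : 'I_n | 0 < x 0 i]|.

(* ||x_-||_0 *)
Definition neg_count (R : realType) (n : nat) (x : 'rV[R]_n) : nat :=
  #|[pred i : 'I_n | x 0 i < 0]|.

Definition gradient (R : realType) (n : nat) (f : 'rV[R]_n -> R)
    (x : 'rV[R]_n) : 'rV[R]_n :=
  \row_(i < n) 'D_(delta_mx 0 i) f x.

Definition lipschitz_gradient (R : realType) (n : nat) (f : 'rV[R]_n -> R)
    (Lf : R) : Prop :=
  forall x y, norm2 (gradient f x - gradient f y) <= Lf * norm2 (x - y).

Definition box (R : realType) (n : nat) (l u : 'I_n -> \bar R) :
    set 'rV[R]_n :=
  [set x | forall i, (l i <= (x 0 i)%:E <= u i)%E].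

Definition level_bounded_on (R : realType) (n : nat) (D : set 'rV[R]_n)
    (f : 'rV[R]_n -> R) : Prop :=
  forall alpha : R, bounded_set [set x | D x /\ f x <= alpha].

Definition objective (R : realType) (n : nat) (f : 'rV[R]_n -> R)
    (lam1 lam2 : R) (x : 'rV[R]_n) : R :=
  f x + lam1 * (pos_count x)%:R + lam2 * (neg_count x)%:R.

Definition local_minimizer (R : realType) (n : nat) (D : set 'rV[R]_n)
    (F : 'rV[R]_n -> R) (xs : 'rV[R]_n) : Prop :=
  D xs /\ exists2 delta : R, 0 < delta &
    forall x, D x -> norm2 (x - xs) <= delta -> F xs <= F x.

Definition argmin (R : realType) (T : Type) (D : set T) (F : T -> R) : set T :=
  [set y | D y /\ forall y', D y' -> F y <= F y'].

(* Omega^k, with x = x^k *)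
Definition step_box (R : realType) (n : nat) (l u : 'I_n -> \bar R) (h : R)
    (x : 'rV[R]_n) : set 'rV[R]_n :=
  [set y | forall i, ((l i - (x 0 i)%:E) * (h^-1)%:E <= (y 0 i)%:E
                      <= (u i - (x 0 i)%:E) * (h^-1)%:E)%E].

Definition Q (R : realType) (n : nat) (lam1 lam2 eps h gamma : R)
    (x z y : 'rV[R]_n) : R :=
  h * eps / (1 + h * gamma) * norm1 y
  + lam1 / (1 + h * gamma) * (pos_count (x + h *: y))%:R
  + lam2 / (1 + h * gamma) * (neg_count (x + h *: y))%:R
  + 2^-1 * norm2 (y - z) ^+ 2.

Definition eht_v (R : realType) (n : nat) (f : 'rV[R]_n -> R)
    (beta h gamma : R) (x xprev : 'rV[R]_n) : 'rV[R]_n :=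
  (h * (1 + h * gamma))^-1 *: (x - xprev)
  - (beta / (1 + h * gamma)) *: (gradient f x - gradient f xprev).

Definition eht_z (R : realType) (n : nat) (f : 'rV[R]_n -> R)
    (beta h gamma : R) (x xprev : 'rV[R]_n) : 'rV[R]_n :=
  eht_v f beta h gamma x xprev - (h / (1 + h * gamma)) *: gradient f x.

(* Sequences the extrapolated hard thresholding algorithm can generate. Since
   0.-1 = 0, writing x^(k-1) as x k.-1 encodes the convention x^(-1) = x^0. *)
Definition eht_sequence (R : realType) (n : nat) (f : 'rV[R]_n -> R)
    (l u : 'I_n -> \bar R) (lam1 lam2 eps beta h gamma : R)
    (x : nat -> 'rV[R]_n) : Prop :=
  box l u (x 0%N) /\
  forall k, exists2 y,
    argmin (step_box l u h (x k))
      (Q lam1 lam2 eps h gamma (x k) (eht_z f beta h gamma (x k) (x k.-1))) y &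
    x k.+1 = x k + h *: y.

(* Main.v *)
Require Import Defs.
From HB Require Import structures.
From mathcomp Require Import all_boot all_order all_algebra.
From mathcomp Require Import all_classical all_reals all_analysis.
From mathcomp Require Import ring lra.
Import Order.TTheory GRing.Theory Num.Theory.
Import numFieldNormedType.Exports.
Local Open Scope classical_set_scope.
Local Open Scope ring_scope.

(**
Put P(w) = lam1 ||w_+||_0 + lam2 ||w_-||_0 and let p^k = x^k + h z^k. In the
variable w = x^k + h y the subproblem is, after scaling, to minimize
P(w) + A/2 ||w - p^k||^2 over the box, where A = (1 + h gamma)/h^2; the new
iterate is such a minimizer ([eht_step_min]).

Boundedness and summability. Comparing x^{k+1} with the competitor w = x^k,
and bounding f(x^{k+1}) by the descent lemma for Lipschitz gradients, the
momentum terms are absorbed by Young's inequality; the result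
([eht_descent]) is that, with constants kappa and sigma,
  F(x^{k+1}) + (kappa + sigma) ||x^{k+1} - x^k||^2
     <= F(x^k) + kappa ||x^k - x^{k-1}||^2,
and sigma > 0 is exactly the strict inequality on gamma. Hence
f(x^k) <= F(x^0), so the iterates stay in a bounded level set; on a bounded set
the convex function f is bounded below by a supporting affine function, so the
telescoped inequality bounds the sums of squared steps.

Accumulation points. The steps tend to 0, so along some subsequence x^{k-1},
x^k and x^{k+1} have the same limit xs, and p^k tends to xs - grad f(xs)/A.
The penalty P is lower semicontinuous, as signs of nonzero coordinates persist
near xs; so the minimizing property of the step passes to the limit
([eht_cluster_stationary]):
  P(xs) <= P(w) + <grad f(xs), w - xs> + A/2 ||w - xs||^2  for all w in the box.
This implies local minimality ([stationary_local_minimizer]). For w in the box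
close to xs, either P(w) > P(xs), and then the penalty has jumped by a fixed
amount that dominates the change of f; or P(w) <= P(xs), and the inequality
applied to the points xs + t (w - xs), which have the same penalty as w, gives
<grad f(xs), w - xs> >= 0 when t tends to 0, whence f(w) >= f(xs) by convexity.
*)

(** * Euclidean geometry of row vectors *)

Definition dot {R : realType} {n : nat} (a b : 'rV[R]_n) : R :=
  \sum_(i < n) a 0 i * b 0 i.

Section Euclidean.
Context {R : realType} {n : nat}.
Implicit Types a b c : 'rV[R]_n.

Lemma dotC a b : dot a b = dot b a.
Proof. by apply: eq_bigr => i _; rewrite mulrC. Qed.

Lemma dotDl a b c : dot (a + b) c = dot a c + dot b c.
Proof. by rewrite /dot -big_split; apply: eq_bigr => i _; rewrite mxE mulrDl. Qed.

Lemma dotZl (t : R) a b : dot (t *: a) b = t * dot a b.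
Proof. by rewrite /dot mulr_sumr; apply: eq_bigr => i _; rewrite mxE mulrA. Qed.

Lemma dotBl a b c : dot (a - b) c = dot a c - dot b c.
Proof. by rewrite dotDl -scaleN1r dotZl mulN1r. Qed.

Lemma dotZr (t : R) a b : dot a (t *: b) = t * dot a b.
Proof. by rewrite dotC dotZl dotC. Qed.

Lemma dotBr a b c : dot a (b - c) = dot a b - dot a c.
Proof. by rewrite dotC dotBl !(dotC a). Qed.

Lemma dot_ge0 a : 0 <= dot a a.
Proof. by apply: sumr_ge0 => i _; rewrite -expr2 sqr_ge0. Qed.

Lemma norm2_ge0 a : 0 <= norm2 a.
Proof. exact: sqrtr_ge0. Qed.

Lemma sqr_norm2 a : norm2 a ^+ 2 = dot a a.
Proof.
rewrite sqr_sqrtr; last by apply: sumr_ge0 => i _; rewrite sqr_ge0.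
by apply: eq_bigr => i _; rewrite expr2.
Qed.

Lemma norm2Z (t : R) a : norm2 (t *: a) = `|t| * norm2 a.
Proof.
apply: (@pexpIrn _ 2) => //; rewrite ?nnegrE ?mulr_ge0 ?norm2_ge0//.
by rewrite exprMn !sqr_norm2 dotZl dotZr mulrA real_normK ?num_real// expr2.
Qed.

Lemma sqr_norm2B a b :
  norm2 (a - b) ^+ 2 = norm2 a ^+ 2 - 2 * dot a b + norm2 b ^+ 2.
Proof. by rewrite !sqr_norm2 dotBl !dotBr (dotC b a); lra. Qed.

Lemma norm2N a : norm2 (- a) = norm2 a.
Proof. by rewrite -scaleN1r norm2Z normrN1 mul1r. Qed.

(** Expanding 0 <= || |b| a - |a| b ||^2 gives the inequality multiplied by
|a| |b|; when this product is 0, one of the vectors vanishes. *)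
Lemma cauchy_schwarz a b : dot a b <= norm2 a * norm2 b.
Proof.
have [/eqP a0|a0] := eqVneq (norm2 a * norm2 b) 0.
  have e0 c : norm2 c = 0 -> forall i, c 0 i = 0.
    move=> c0 i; apply/eqP; rewrite -sqrf_eq0 eq_le sqr_ge0 andbT.
    rewrite -[leRHS](expr0n R 2) -c0 sqr_norm2 /dot (bigD1 i)//= -expr2 lerDl.
    by apply: sumr_ge0 => j _; rewrite -expr2 sqr_ge0.
  rewrite (eqP a0) /dot big1// => i _.
  by move: a0; rewrite mulf_eq0 => /orP[] /eqP /e0 ->; rewrite ?mul0r ?mulr0.
have p_gt0 : 0 < norm2 a * norm2 b by rewrite lt_neqAle eq_sym a0 mulr_ge0 ?norm2_ge0.
have := dot_ge0 (norm2 b *: a - norm2 a *: b).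
rewrite dotBl !dotBr !dotZl !dotZr -!sqr_norm2 (dotC b a) => H.
rewrite -(ler_pM2l p_gt0); move: H.
set s := norm2 a; set t := norm2 b; set d := dot a b => H.
rewrite -subr_ge0; nra.
Qed.

Lemma abs_coord_le_norm2 a i : `|a 0 i| <= norm2 a.
Proof.
rewrite -(@ler_pXn2r _ 2) ?nnegrE ?norm2_ge0// sqr_norm2 real_normK ?num_real//.
rewrite /dot (bigD1 i)//= -expr2 lerDl.
by apply: sumr_ge0 => j _; rewrite -expr2 sqr_ge0.
Qed.

Lemma mx_norm_le_norm2 a : `|a| <= norm2 a.
Proof.
rewrite [leLHS]mx_normrE; apply/bigmax_leP; split=> [|[i j] _ /=].
  exact: norm2_ge0.
by rewrite ord1 abs_coord_le_norm2.
Qed.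

(** With [mx_norm_le_norm2], this transfers boundedness and limits between the
Euclidean norm and the sup norm that carries the topology. *)
Lemma norm2_le_mx_norm a : norm2 a <= Num.sqrt n%:R * `|a|.
Proof.
have coord_le i : `|a 0 i| <= `|a|.
  by rewrite [leRHS]mx_normrE; rewrite (bigmaxD1 (0, i))//= le_max lexx.
rewrite -(@ler_pXn2r _ 2) ?nnegrE ?mulr_ge0 ?norm2_ge0 ?sqrtr_ge0//.
rewrite sqr_norm2 exprMn sqr_sqrtr// mulr_natl.
rewrite -[X in _ *+ X]card_ord -sumr_const; apply: ler_sum => i _.
by rewrite -expr2 -real_normK ?num_real// lerXn2r// nnegrE.
Qed.
End Euclidean.

(** * Limits of sequences of row vectors *)

Section Convergence.
Context {R : realType} {n : nat}.
Implicit Types (a b : nat -> 'rV[R]_n).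

Lemma cvg_coord a (p : 'rV[R]_n) i :
  a @ \oo --> p -> (a k 0 i) @[k --> \oo] --> p 0 i.
Proof.
by move=> ap; exact: cvg_comp _ _ ap (@coord_continuous R 1 n 0 i p).
Qed.

Lemma cvg_dot a b (p q : 'rV[R]_n) : a @ \oo --> p -> b @ \oo --> q ->
  dot (a k) (b k) @[k --> \oo] --> dot p q.
Proof.
move=> ap bq; apply: cvg_big => [|i _]; first exact: add_continuous.
by apply: cvgM; exact: cvg_coord.
Qed.

Lemma cvg_norm2B a (p : 'rV[R]_n) : a @ \oo --> p ->
  norm2 (a k - p) @[k --> \oo] --> 0.
Proof.
move=> ap.
have bound_cvg : Num.sqrt n%:R * `|a k - p| @[k --> \oo] --> 0.
  rewrite -(mulr0 (Num.sqrt n%:R)); apply: cvgM; first exact: cvg_cst.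
  by apply/norm_cvg0P/subr_cvg0.
apply: (squeeze_cvgr _ (cvg_cst 0) bound_cvg); apply: nearW => k.
by rewrite norm2_ge0 norm2_le_mx_norm.
Qed.

Lemma lipschitz_cvg_gradient (f : 'rV[R]_n -> R) (L : R) a (p : 'rV[R]_n) :
  lipschitz_gradient f L -> a @ \oo --> p ->
  gradient f (a k) @[k --> \oo] --> gradient f p.
Proof.
move=> f_lip ap; apply/subr_cvg0; apply/norm_cvg0P.
have bound_cvg : L * norm2 (a k - p) @[k --> \oo] --> 0.
  by rewrite -(mulr0 L); apply: cvgM; [exact: cvg_cst|exact: cvg_norm2B].
apply: (squeeze_cvgr _ (cvg_cst 0) bound_cvg); apply: nearW => k.
by rewrite normr_ge0 /= (le_trans (mx_norm_le_norm2 _))// f_lip.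
Qed.
End Convergence.

(** * Quadratic upper bound and affine lower bound from the gradient *)

Section Gradient.
Context {R : realType} {n : nat} (f : 'rV[R]_n -> R).
Context (f_diff : forall y, differentiable f y).

Lemma derive_gradient (y v : 'rV[R]_n) : 'D_v f y = dot (gradient f y) v.
Proof.
rewrite deriveE// {1}(row_sum_delta v) linear_sum; apply: eq_bigr => i _.
by rewrite linearZ mxE deriveE// mulrC.
Qed.

(** The difference quotient of s |-> f (y + s v) at t is literally the one that
defines the directional derivative of f at y + t v. *)
Lemma is_derive_line (y v : 'rV[R]_n) (t : R) :
  is_derive t 1 (fun s : R => f (y + s *: v)) (dot (gradient f (y + t *: v)) v).
Proof.
have E : (fun s : R => s^-1 *: (((fun s : R => f (y + s *: v)) \o shift t) (s *: 1) -
      f (y + t *: v))) =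
    (fun s => s^-1 *: ((f \o shift (y + t *: v)) (s *: v) - f (y + t *: v))).
  apply/funext => s /=; congr (_ *: (f _ - _)).
  by rewrite [s *: 1]mulr1 scalerDl addrCA.
split.
  rewrite /derivable E.
  have := f_diff (y + t *: v) => /(@diff_derivable _ _ _ f _ v). exact.
by rewrite -derive_gradient /derive E.
Qed.

(** The mean value theorem applied to the gap g between f and its quadratic
model along the segment from y to z: the Lipschitz bound makes g' <= 0. The
constant L/2 matters: for convex f the supporting hyperplane at z would give L
more cheaply, but that is too weak for the condition on gamma. *)
Lemma descent_lemma (L : R) (y z : 'rV[R]_n) : lipschitz_gradient f L ->
  f z <= f y + dot (gradient f y) (z - y) + L / 2 * norm2 (z - y) ^+ 2.
Proof.
move=> f_lip; set d := z - y.
pose g (t : R) :=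
  f (y + t *: d) - (t * dot (gradient f y) d + L / 2 * norm2 d ^+ 2 * t ^+ 2).
pose g' (t : R) :=
  dot (gradient f (y + t *: d)) d - (dot (gradient f y) d + L * norm2 d ^+ 2 * t).
have dg (t : R) : is_derive t 1 g (g' t).
  apply: is_deriveB; first exact: is_derive_line.
  apply: is_derive_eq.
  by rewrite /GRing.scale /=; field.
have g_cont : {within `[0, 1], continuous g}.
  apply: derivable_within_continuous => t _.
  by have [] := dg t.
have [c /itvP c01] := @MVT R g g' 0 1 ltr01 (fun t _ => dg t) g_cont.
rewrite /g /g' scale1r scale0r addr0 subr0 mulr1 !mul1r expr1n.
rewrite mul0r expr0n mulr0 addr0 subr0 mulr1 /d addrCA subrr addr0 -/d => gE.
have /(le_trans (cauchy_schwarz _ _)) :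
    norm2 (gradient f (y + c *: d) - gradient f y) * norm2 d <= L * norm2 d ^+ 2 * c.
  have := f_lip (y + c *: d) y.
  rewrite [y + _]addrC addrK norm2Z ger0_norm ?c01// addrC => H.
  by apply: le_trans (ler_wpM2r (norm2_ge0 d) H) _; rewrite expr2; lra.
rewrite dotBl; move: gE; lra.
Qed.

(** By convexity the slopes of f from y towards z are at most f z - f y; their
limit is the directional derivative. *)
Lemma convex_gradient_le (y z : 'rV[R]_n) : convex_function setT f ->
  f y + dot (gradient f y) (z - y) <= f z.
Proof.
move=> f_conv.
set d := z - y.
have line_le (s : R) : 0 < s -> s <= 1 -> s^-1 * (f (y + s *: d) - f y) <= f z - f y.
  move=> s0 s1; rewrite ler_pdivrMl// lerBlDl.
  have le_conv : f (s *: z + (1 - s) *: y) <= s * f z + (1 - s) * f y :=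
    f_conv (Itv01 (ltW s0) s1) z y (in_setT _) (in_setT _).
  have -> : y + s *: d = s *: z + (1 - s) *: y.
    by rewrite /d scalerBl scalerBr scale1r addrCA.
  by move: le_conv; lra.
have [/cvg_ex[l l_cvg] dE] := is_derive_line y d 0.
have lE : l = dot (gradient f y) d.
  by move: dE; rewrite /derive (cvg_lim _ l_cvg)// scale0r addr0.
rewrite -lE -lerBrDl.
have l_right := cvg_dnbhs_at_right l_cvg.
rewrite -(cvg_lim _ l_right)//; apply: limr_le; first by apply/cvg_ex; exists l.
near=> s => /=.
rewrite scale0r !addr0 [s *: 1]mulr1.
by apply: line_le; near: s; [exact: nbhs_right_gt|exact: nbhs_right_le].
Unshelve. all: by end_near.
Qed.
End Gradient.

(** * The subproblem in the original variable *)

Definition penalty {R : realType} {n : nat} (lam1 lam2 : R) (w : 'rV[R]_n) : R :=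
  lam1 * (pos_count w)%:R + lam2 * (neg_count w)%:R.

Section Model.
Context {R : realType} {n : nat}.
Implicit Types (w x y z : 'rV[R]_n) (l u : 'I_n -> \bar R).

Lemma step_boxE l u (h : R) x y : 0 < h ->
  step_box l u h x y <-> box l u (x + h *: y).
Proof.
move=> h0; rewrite /step_box /box /=.
have E i : ((l i - (x 0 i)%:E) * (h^-1)%:E <= (y 0 i)%:E <=
     (u i - (x 0 i)%:E) * (h^-1)%:E)%E = (l i <= ((x + h *: y) 0 i)%:E <= u i)%E.
  rewrite lee_pdivrMr// lee_pdivlMr// leeBlDr// leeBrDr// -!EFinM -!EFinD !mxE.
  by rewrite addrC [h * _]mulrC.
by split=> H i; move: (H i); rewrite E.
Qed.

(** In the variable w = x + h y the feasible set no longer depends on x, so the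
next iterate can be compared with arbitrary points of the box. *)
Lemma Q_model (lam1 lam2 h gamma : R) x z y : 0 < h -> 0 < gamma ->
  (1 + h * gamma) * Q lam1 lam2 0 h gamma x z y =
  penalty lam1 lam2 (x + h *: y) +
  (1 + h * gamma) / h ^+ 2 / 2 * norm2 (x + h *: y - (x + h *: z)) ^+ 2.
Proof.
move=> h0 g0; have d0 : 1 + h * gamma != 0 by rewrite gt_eqF// addr_gt0// mulr_gt0.
have -> : x + h *: y - (x + h *: z) = h *: (y - z).
  by rewrite opprD addrACA subrr add0r scalerBr.
rewrite norm2Z gtr0_norm// /Q /penalty; field.
by rewrite d0 gt_eqF.
Qed.

End Model.

(** * From a quadratic model inequality to local minimality *)

Section LocalMinimality.
Context {R : realType} {n : nat}.
Implicit Types (w xs : 'rV[R]_n) (l u : 'I_n -> \bar R).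

Lemma box_segment l u xs w (t : R) : 0 <= t -> t <= 1 ->
  box l u xs -> box l u w -> box l u (xs + t *: (w - xs)).
Proof.
move=> t0 t1 xsB wB i; rewrite !mxE.
move: (xsB i) (wB i) => /andP[lx xu] /andP[lw wu].
apply/andP; split.
  case: (l i) lx lw => [r||]; rewrite ?lee_fin ?leye_eq ?leNye//; nra.
case: (u i) xu wu => [r||]; rewrite ?lee_fin ?leeNy_eq ?leey//; nra.
Qed.

Lemma box_closed l u (a : nat -> 'rV[R]_n) xs :
  (forall k, box l u (a k)) -> a @ \oo --> xs -> box l u xs.
Proof.
move=> aB a_xs i; have ai := cvg_coord a xs i a_xs.
apply/andP; split.
  case: (l i) (fun k => aB k i) => [r H|H|_]; rewrite ?leNye//.
    rewrite lee_fin; apply: (cvgr_to_ge ai); apply: nearW => k.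
    by have /andP[] := H k.
  by move: (H 0%N); rewrite leye_eq.
case: (u i) (fun k => aB k i) => [r H|_|H]; rewrite ?leey//.
  rewrite lee_fin; apply: (cvgr_to_le ai); apply: nearW => k.
  by have /andP[] := H k.
by move: (H 0%N); rewrite leeNy_eq andbF.
Qed.

(** All that the counts can see of the closeness of w to xs; unlike closeness it
involves no radius. *)
Definition sign_refines xs w :=
  forall i, (0 < xs 0 i -> 0 < w 0 i) /\ (xs 0 i < 0 -> w 0 i < 0).

(** The radius is the minimum of the nonzero |xs_i|, capped by 1 so that it exists
even when xs = 0. *)
Lemma near_sign_refines xs :
  exists2 r : R, 0 < r & forall w, norm2 (w - xs) < r -> sign_refines xs w.
Proof.
exists (\big[Order.min/1]_(i < n | xs 0 i != 0) `|xs 0 i|).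
  by apply: lt_bigmin => // i; rewrite normr_gt0.
move=> w w_near i.
have lt_i : xs 0 i != 0 -> `|w 0 i - xs 0 i| < `|xs 0 i|.
  move=> xi0; have := abs_coord_le_norm2 (w - xs) i; rewrite !mxE => /le_lt_trans; apply.
  by apply: lt_le_trans w_near _; exact: bigmin_le_cond.
split=> xi.
  have /lt_i : xs 0 i != 0 by rewrite gt_eqF.
  by rewrite (gtr0_norm xi) ltr_norml; lra.
have /lt_i : xs 0 i != 0 by rewrite lt_eqF.
by rewrite (ltr0_norm xi) ltr_norml; lra.
Qed.

Lemma sign_refines_counts xs w : sign_refines xs w ->
  (pos_count xs <= pos_count w)%N /\ (neg_count xs <= neg_count w)%N.
Proof.
by move=> sgn; split; apply: subset_leq_card; apply/fintype.subsetP => i; rewrite !inE;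
  case: (sgn i).
Qed.

(** Moving from w towards xs, short of xs, changes no sign: coordinates where xs
is nonzero lie between two numbers of the same sign, and the others are scaled
by t > 0. *)
Lemma penalty_segment (lam1 lam2 : R) xs w (t : R) : 0 < t -> t <= 1 ->
  sign_refines xs w ->
  penalty lam1 lam2 (xs + t *: (w - xs)) = penalty lam1 lam2 w.
Proof.
move=> t0 t1 sgn.
have sgnE i : ((0 < (xs + t *: (w - xs)) 0 i) = (0 < w 0 i)) /\
    (((xs + t *: (w - xs)) 0 i < 0) = (w 0 i < 0)).
  have [xw_pos xw_neg] := sgn i; rewrite !mxE.
  have [xi|xi|xi] := ltgtP (xs 0 i) 0.
  - have wi := xw_neg xi.
    have si : xs 0 i + t * (w 0 i - xs 0 i) < 0.
      have : t * w 0 i < 0 by rewrite pmulr_rlt0.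
      have : (1 - t) * xs 0 i <= 0 by rewrite mulr_ge0_le0 ?subr_ge0// ltW.
      lra.
    by rewrite si wi (lt_gtF si) (lt_gtF wi).
  - have wi := xw_pos xi.
    have si : 0 < xs 0 i + t * (w 0 i - xs 0 i).
      have : 0 < t * w 0 i by rewrite mulr_gt0.
      have : 0 <= (1 - t) * xs 0 i by rewrite mulr_ge0 ?subr_ge0// ltW.
      lra.
    by rewrite si wi (lt_gtF si) (lt_gtF wi).
  - by rewrite xi subr0 add0r pmulr_rgt0// pmulr_rlt0.
by rewrite /penalty; congr (_ * _%:R + _ * _%:R); apply: eq_card => i; rewrite !inE;
  case: (sgnE i).
Qed.

(** Near xs both counts can only grow, so the penalty increases by at least the
smallest nonzero weight, or not at all. The case lam2 = 0 is apart: negative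
coordinates are then free of charge. *)
Lemma penalty_gap (lam1 lam2 : R) : 0 < lam1 -> 0 <= lam2 ->
  exists2 m : R, 0 < m & forall xs w, sign_refines xs w ->
    penalty lam1 lam2 xs < penalty lam1 lam2 w ->
    penalty lam1 lam2 xs + m <= penalty lam1 lam2 w.
Proof.
move=> lam1_gt0 lam2_ge0.
exists (if lam2 == 0 then lam1 else Order.min lam1 lam2).
  by case: eqP => // /eqP lam2_neq0; rewrite lt_min lam1_gt0 lt_neqAle eq_sym lam2_neq0.
move=> xs w /sign_refines_counts[]; rewrite /penalty.
move: (pos_count xs) (pos_count w) (neg_count xs) (neg_count w) => p p' q q' pp' qq'.
have mul_le (c : R) a b : 0 <= c -> (a <= b)%N -> c * a%:R <= c * b%:R.
  by move=> c0 ab; rewrite ler_wpM2l// ler_nat.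
have := mul_le _ _ _ lam2_ge0 qq'.
have m_le : (if lam2 == 0 then lam1 else Order.min lam1 lam2) <= lam1.
  by case: ifP => // _; rewrite ge_min lexx.
move: pp'; rewrite leq_eqVlt => /orP[/eqP <-|].
  move=> _; rewrite ltrD2l => lt_neg.
  have lam2_neq0 : lam2 != 0 by apply: contraTneq lt_neg => ->; rewrite !mul0r ltxx.
  have q_lt : (q < q')%N.
    by rewrite ltnNge; apply: contraTN lt_neg => qq; rewrite -leNgt mul_le.
  have := mul_le _ _ _ lam2_ge0 q_lt.
  rewrite (negPf lam2_neq0) -natr1 mulrDr mulr1.
  have : Order.min lam1 lam2 <= lam2 by rewrite ge_min lexx orbT.
  lra.
move=> p_lt neg_le _; have := mul_le _ _ _ (ltW lam1_gt0) p_lt.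
rewrite -natr1 mulrDr mulr1; lra.
Qed.

(** Divide by t and let t tend to 0. *)
Lemma slope_ge0 (D K : R) :
  (forall t : R, 0 < t -> t <= 1 -> 0 <= t * D + t ^+ 2 * K) -> 0 <= D.
Proof.
move=> H; apply/ler_addgt0Pr => e e0.
have K0 : 0 < `|K| + 1 by rewrite ltr_wpDl.
pose t := Order.min 1 (e / (`|K| + 1)).
have t0 : 0 < t by rewrite lt_min ltr01 divr_gt0.
have t1 : t <= 1 by rewrite ge_min lexx.
have tK : t * (`|K| + 1) <= e by rewrite -ler_pdivlMr// ge_min lexx orbT.
have : 0 <= D + t * K.
  by rewrite -(pmulr_rge0 _ t0) mulrDr mulrA -expr2; exact: H.
have : t * K <= t * `|K| by rewrite ler_pM2l// ler_norm.
by move: tK; rewrite mulrDr mulr1; lra.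
Qed.

(** Close to xs the penalty is either at least P(xs) + m, and then the affine
lower bound on f loses at most m; or equal to P(xs) on the whole half-open
segment from xs to w, and then the model inequality along this segment forces a
nonnegative slope. *)
Lemma stationary_local_minimizer (f : 'rV[R]_n -> R) l u (lam1 lam2 c : R) xs :
  (forall y, differentiable f y) -> convex_function setT f ->
  0 < lam1 -> 0 <= lam2 -> box l u xs ->
  (forall w, box l u w -> penalty lam1 lam2 xs <=
     penalty lam1 lam2 w + dot (gradient f xs) (w - xs) + c * norm2 (w - xs) ^+ 2) ->
  local_minimizer (box l u) (objective f lam1 lam2) xs.
Proof.
move=> f_diff f_convex lam1_gt0 lam2_ge0 xsB xs_stat; split => //.
have [r r0 r_sgn] := near_sign_refines xs.
have [m m0 gap] := penalty_gap lam1 lam2 lam1_gt0 lam2_ge0.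
have g0 : 0 < norm2 (gradient f xs) + 1 by rewrite ltr_wpDl// norm2_ge0.
(* Within the second radius, Cauchy-Schwarz gives |<grad f(xs), w - xs>| <= m. *)
exists (Order.min (r / 2) (m / (norm2 (gradient f xs) + 1))).
  by rewrite lt_min !divr_gt0.
move=> w wB; rewrite le_min => /andP[w_r w_m].
have sgn : sign_refines xs w by apply: r_sgn; lra.
rewrite /objective -!addrA -!/(penalty _ _ _).
have := convex_gradient_le f f_diff xs w f_convex.
have [pen_le|pen_gt] := leP (penalty lam1 lam2 w) (penalty lam1 lam2 xs).
  suff : 0 <= dot (gradient f xs) (w - xs).
    have := xs_stat w wB.
    have [cnt1 cnt2] := sign_refines_counts xs w sgn.
    have : penalty lam1 lam2 xs <= penalty lam1 lam2 w.
      by rewrite lerD// ler_wpM2l ?ler_nat// ltW.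
    lra.
  apply: (slope_ge0 _ (c * norm2 (w - xs) ^+ 2)) => t t0 t1.
  have := xs_stat _ (box_segment l u xs w t (ltW t0) t1 xsB wB).
  have -> : xs + t *: (w - xs) - xs = t *: (w - xs) by rewrite addrAC subrr add0r.
  rewrite penalty_segment// dotZr norm2Z gtr0_norm// exprMn.
  lra.
have := gap _ _ sgn pen_gt.
have := cauchy_schwarz (- gradient f xs) (w - xs).
rewrite norm2N -scaleN1r dotZl mulN1r.
move: w_m; rewrite ler_pdivlMr// mulrDr mulr1 mulrC.
have := norm2_ge0 (w - xs); lra.
Qed.

End LocalMinimality.

(** * Descent along the iterates *)

Section Algorithm.
Context {R : realType} {n : nat}.
Context {f : 'rV[R]_n -> R} {Lf lam1 lam2 beta h gamma : R}.
Context {l u : 'I_n -> \bar R} {x : nat -> 'rV[R]_n}.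
Context (f_diff : forall y : 'rV[R]_n, differentiable f y).
Context (f_lip : lipschitz_gradient f Lf).
Context (lam1_gt0 : 0 < lam1) (lam2_ge0 : 0 <= lam2) (beta_ge0 : 0 <= beta).
Context (h_gt0 : 0 < h) (gamma_gt0 : 0 < gamma).
Context (gamma_gt : h^-1 + (2 * beta + h) * Lf < gamma).
Context (x_eht : eht_sequence f l u lam1 lam2 0 beta h gamma x).

Let z k := eht_z f beta h gamma (x k) (x k.-1).
Let A := (1 + h * gamma) / h ^+ 2.

Lemma eht_in_box k : box l u (x k).
Proof.
have [x0 xS] := x_eht; case: k => [//|k].
by have [y [yB _] ->] := xS k; apply/step_boxE.
Qed.

Lemma eht_step_min k w : box l u w ->
  penalty lam1 lam2 (x k.+1) + A / 2 * norm2 (x k.+1 - (x k + h *: z k)) ^+ 2 <=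
  penalty lam1 lam2 w + A / 2 * norm2 (w - (x k + h *: z k)) ^+ 2.
Proof.
move=> wB; have [_ /(_ k) [y [yB y_min] ->]] := x_eht.
have wE : w = x k + h *: (h^-1 *: (w - x k)).
  by rewrite scalerA divff ?gt_eqF// scale1r addrC subrK.
rewrite {}wE in wB *.
have /y_min := (step_boxE _ _ _ _ _ h_gt0).2 wB.
rewrite -!Q_model// ler_pM2l//.
by rewrite addr_gt0// mulr_gt0.
Qed.

(** The scaling isolates the gradient step: the coefficient of grad f(x^k) is
-1, which cancels the linear term of the descent lemma. *)
Lemma eht_zE k : (1 + h * gamma) / h *: z k =
  h ^- 2 *: (x k - x k.-1) - (beta / h) *: (gradient f (x k) - gradient f (x k.-1))
  - gradient f (x k).
Proof.
have d0 : 1 + h * gamma != 0 by rewrite gt_eqF// addr_gt0// mulr_gt0.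
have h0 : h != 0 by rewrite gt_eqF.
rewrite /z /eht_z /eht_v !scalerBr !scalerA.
have -> : (1 + h * gamma) / h * (h * (1 + h * gamma))^-1 = h ^- 2.
  by field; rewrite h0.
have -> : (1 + h * gamma) / h * (beta / (1 + h * gamma)) = beta / h.
  by field; rewrite h0.
have -> : (1 + h * gamma) / h * (h / (1 + h * gamma)) = 1.
  by rewrite mulrA divfK// divff.
by rewrite scale1r.
Qed.

(** A substitute for 0 <= Lf that also holds in dimension 0, where Lf may be
negative. *)
Lemma lipschitz_mul_norm2_ge0 (v : 'rV[R]_n) : 0 <= Lf * norm2 v.
Proof. by have := f_lip v 0; rewrite subr0; apply: le_trans; exact: norm2_ge0. Qed.

(** kappa is the weight with which the previous squared step enters after Young's
inequality on both momentum terms; sigma is what remains of the new squared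
step once the next potential F + kappa ||step||^2 is paid. *)
Let kappa := (h ^- 2 + beta * Lf / h) / 2.
Let sigma := (gamma - h^-1 - (2 * beta + h) * Lf) / (2 * h).

Lemma sigma_gt0 : 0 < sigma.
Proof. by rewrite divr_gt0 ?mulr_gt0// -addrA -opprD subr_gt0. Qed.

(** The competitor w = x^k in the subproblem, combined with the descent lemma.
The terms <step, z> split by [eht_zE] into a gradient part, which cancels, and
two momentum parts, each at most a multiple of half the sum of the two squared
steps. *)
Lemma eht_descent k :
  objective f lam1 lam2 (x k.+1) + (kappa + sigma) * norm2 (x k.+1 - x k) ^+ 2 <=
  objective f lam1 lam2 (x k) + kappa * norm2 (x k - x k.-1) ^+ 2.
Proof.
have := eht_step_min k (x k) (eht_in_box k).
have -> : x k.+1 - (x k + h *: z k) = (x k.+1 - x k) - h *: z k.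
  by rewrite opprD addrA.
have -> : x k - (x k + h *: z k) = - (h *: z k).
  by rewrite opprD addrA subrr add0r.
have := descent_lemma f f_diff Lf (x k) (x k.+1) f_lip.
have lip := f_lip (x k) (x k.-1).
have := eht_zE k.
set dp := x k.+1 - x k; set d := x k - x k.-1; set g := gradient f (x k).
set e := g - _ => zE f_le P_le.
have Az_dot : A * (h * dot dp (z k)) = h ^- 2 * dot dp d - beta / h * dot dp e - dot dp g.
  rewrite -!dotZr -!dotBr -zE !dotZr /A; field.
  by rewrite gt_eqF.
have dot_le : dot dp d <= (norm2 dp ^+ 2 + norm2 d ^+ 2) / 2.
  have := sqr_ge0 (norm2 (dp - d)); rewrite sqr_norm2B; lra.
have e_le : - dot dp e <= Lf * (norm2 dp ^+ 2 + norm2 d ^+ 2) / 2.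
  have := cauchy_schwarz (- dp) e; rewrite norm2N -scaleN1r dotZl mulN1r.
  move/le_trans; apply.
  apply: le_trans (ler_wpM2l (norm2_ge0 dp) lip) _.
  have := lipschitz_mul_norm2_ge0 dp; have := lipschitz_mul_norm2_ge0 d.
  have := norm2_ge0 dp; have := norm2_ge0 d.
  rewrite -/d; set s := norm2 dp; set t := norm2 d => t0 s0 Lt0 Ls0.
  (* A negative Lf forces s = t = 0. *)
  have [Lf0|Lf0] := leP 0 Lf; first by have := mulr_ge0 Lf0 (sqr_ge0 (s - t)); lra.
  have -> : s = 0 by nra.
  by have -> : t = 0 by [nra]; rewrite expr2 !mul0r addr0 mulr0 mul0r.
have b0 : 0 <= beta / h by rewrite divr_ge0// ltW.
have h20 : 0 <= h ^- 2 by rewrite invr_ge0 exprn_ge0// ltW.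
have := ler_wpM2l b0 e_le; have := ler_wpM2l h20 dot_le.
have coefE : kappa + sigma = A / 2 - h ^- 2 / 2 - beta * Lf / h / 2 - Lf / 2.
  rewrite /kappa /sigma /A; field.
  by rewrite gt_eqF.
move: P_le f_le Az_dot.
rewrite norm2N sqr_norm2B dotZr -/g (dotC g) coefE /kappa /objective /penalty.
lra.
Qed.

(** The initial potential is F(x^0) alone because x^{-1} = x^0. *)
Lemma eht_telescope N :
  objective f lam1 lam2 (x N) + kappa * norm2 (x N - x N.-1) ^+ 2 +
    sigma * \sum_(0 <= k < N) norm2 (x k.+1 - x k) ^+ 2 <=
  objective f lam1 lam2 (x 0%N).
Proof.
elim: N => [|N IH].
  by rewrite big_geq// subrr -(scale0r 0) norm2Z normr0 mul0r expr0n !mulr0 !addr0.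
rewrite big_nat_recr//=; apply: le_trans IH.
have := eht_descent N; lra.
Qed.

Lemma kappa_mul_sqr_norm2_ge0 (v : 'rV[R]_n) : 0 <= kappa * norm2 v ^+ 2.
Proof.
have -> : kappa * norm2 v ^+ 2 =
    (h ^- 2 * norm2 v ^+ 2 + beta / h * (Lf * norm2 v) * norm2 v) / 2.
  by rewrite /kappa; field; rewrite gt_eqF.
have beta_h : 0 <= beta / h by rewrite divr_ge0// ltW.
rewrite divr_ge0// addr_ge0//; first by rewrite mulr_ge0 ?invr_ge0 ?sqr_ge0.
by rewrite (mulr_ge0 (mulr_ge0 _ _))// ?norm2_ge0// lipschitz_mul_norm2_ge0.
Qed.

Lemma le_objective (w : 'rV[R]_n) : f w <= objective f lam1 lam2 w.
Proof. by rewrite /objective -addrA lerDl addr_ge0// mulr_ge0// ltW. Qed.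

Lemma eht_value_le k : f (x k) <= objective f lam1 lam2 (x 0%N).
Proof.
apply: le_trans (le_objective _) _; apply: le_trans (eht_telescope k).
rewrite -addrA lerDl addr_ge0 ?kappa_mul_sqr_norm2_ge0//.
rewrite mulr_ge0 ?(ltW sigma_gt0)//.
by apply: sumr_ge0 => i _; rewrite sqr_ge0.
Qed.

Lemma eht_bounded : level_bounded_on (box l u) f ->
  exists2 M : R, 0 < M & forall k, norm2 (x k) <= M.
Proof.
move=> /(_ (objective f lam1 lam2 (x 0%N))) [M0 [_ M0P]].
have M0_lt : M0 < `|M0| + 1 by rewrite (le_lt_trans (ler_norm M0))// ltrDl.
exists (1 + Num.sqrt n%:R * (`|M0| + 1)).
  by rewrite ltr_pwDl// mulr_ge0// addr_ge0.
move=> k; rewrite (le_trans (norm2_le_mx_norm _))//.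
rewrite (@le_trans _ _ (Num.sqrt n%:R * (`|M0| + 1)))// ?lerDr//.
rewrite ler_wpM2l//; apply: (M0P _ M0_lt); split; first exact: eht_in_box.
exact: eht_value_le.
Qed.

(** * Summability of the steps *)

Context (f_convex : convex_function setT f).
Context (f_level : level_bounded_on (box l u) f).

(** Convexity supplies the lower bound f(0) - |grad f(0)| M for f on the iterates,
so what the telescoped inequality consumes is finite. *)
Lemma eht_sum_bounded :
  exists C : R, forall N, \sum_(0 <= k < N) norm2 (x k.+1 - x k) ^+ 2 <= C.
Proof.
have [M M0 xM] := eht_bounded f_level.
exists ((objective f lam1 lam2 (x 0%N) - f 0 + norm2 (gradient f 0) * M) / sigma) => N.
rewrite ler_pdivlMr ?sigma_gt0// mulrC.
have := eht_telescope N; have := kappa_mul_sqr_norm2_ge0 (x N - x N.-1).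
have := le_objective (x N).
have := convex_gradient_le f f_diff 0 (x N) f_convex; rewrite subr0.
have := cauchy_schwarz (- gradient f 0) (x N).
rewrite norm2N -scaleN1r dotZl mulN1r.
have := ler_wpM2l (norm2_ge0 (gradient f 0)) (xM N).
lra.
Qed.

Lemma eht_series_lty : (\sum_(0 <= k <oo) (norm2 (x k.+1 - x k) ^+ 2)%:E < +oo)%E.
Proof.
have [C sumC] := eht_sum_bounded.
apply: le_lt_trans (ltry C); apply: lime_le.
  by apply: is_cvg_nneseries => k _ _; rewrite lee_fin sqr_ge0.
by apply: nearW => N; rewrite sumEFin lee_fin.
Qed.

Lemma eht_step_cvg0 : x k.+1 - x k @[k --> \oo] --> (0 : 'rV[R]_n).
Proof.
have [C sumC] := eht_sum_bounded.
have sq_cvg0 : norm2 (x k.+1 - x k) ^+ 2 @[k --> \oo] --> 0.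
  apply: cvg_series_cvg_0; apply: nondecreasing_is_cvgn.
    apply/nondecreasing_seqP => N; rewrite /series/= big_nat_recr//= lerDl.
    exact: sqr_ge0.
  by exists C => _ [N _ <-]; exact: sumC.
apply/cvgr0Pnorm_le => e e0.
have e20 : 0 < e ^+ 2 by rewrite exprn_gt0.
have := sq_cvg0; move/cvgr0Pnorm_le => /(_ _ e20).
apply: filterS => k; rewrite ger0_norm ?sqr_ge0// => H.
rewrite (le_trans (mx_norm_le_norm2 _))//.
by rewrite -(@ler_pXn2r _ 2) ?nnegrE ?norm2_ge0// ltW.
Qed.

(** * Accumulation points *)

(** Since the steps tend to 0, an index k at which x^k is close to xs can be taken
so large that both neighbouring iterates are close to xs too. *)
Lemma eht_cluster_subseq (xs : 'rV[R]_n) :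
  cluster (x @ \oo) xs ->
  exists phi : nat -> nat, [/\ x (phi j) @[j --> \oo] --> xs,
    x (phi j).+1 @[j --> \oo] --> xs & x (phi j).-1 @[j --> \oo] --> xs].
Proof.
move=> xs_cl; have step0 := eht_step_cvg0.
have near_idx (j : nat) : exists k, [/\ `|xs - x k| <= j.+1%:R^-1,
    `|x k.+1 - x k| <= j.+1%:R^-1 & `|x k - x k.-1| <= j.+1%:R^-1].
  have e0 : 0 < (j.+1%:R^-1 : R) by [].
  have /cvgr0Pnorm_le /(_ _ e0) [N _ NP] := step0.
  have /xs_cl /(_ (nbhsx_ballx xs _ e0)) [_ [[k Nk <-]]] :
    (x @ \oo) [set x k | k in [set k | (N.+1 <= k)%N]].
    by exists N.+1 => // k Nk; exists k.
  rewrite -ball_normE /= => xk; exists k; split; first exact: ltW.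
    by apply: NP => /=; exact: ltnW.
  case: k Nk {xk} => [//|k] Nk; exact: NP.
have [phi phiP] := choice near_idx.
have harm : (fun j : nat => (j.+1%:R^-1 : R)) @ \oo --> 0 := cvg_harmonic.
have to0 (d : nat -> 'rV[R]_n) :
    (forall j, `|d j| <= j.+1%:R^-1) -> d @ \oo --> (0 : 'rV[R]_n).
  move=> dP; apply/norm_cvg0P.
  by apply: (squeeze_cvgr _ (cvg_cst 0) harm); apply: nearW => j; rewrite normr_ge0 dP.
have c0 : x (phi j) @[j --> \oo] --> xs.
  by apply/subr_cvg0; apply: to0 => j; rewrite distrC; case: (phiP j).
exists phi; split => //.
- rewrite -[X in _ --> X]add0r.
  have -> : (fun j => x (phi j).+1) = (fun j => (x (phi j).+1 - x (phi j)) + x (phi j)).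
    by apply/funext => j; rewrite subrK.
  by apply: cvgD => //; apply: to0 => j; case: (phiP j).
- rewrite -[X in _ --> X]subr0.
  have -> : (fun j => x (phi j).-1) = (fun j => x (phi j) - (x (phi j) - x (phi j).-1)).
    by apply/funext => j; rewrite subKr.
  by apply: cvgB => //; apply: to0 => j; case: (phiP j).
Qed.

(** The limit of [eht_step_min] along the subsequence. On the left the penalty of
the iterates may be replaced by the smaller P(xs); the quadratic terms converge,
and expanding them around xs - grad f(xs)/A leaves the linear term. *)
Lemma eht_cluster_stationary (xs w : 'rV[R]_n) :
  cluster (x @ \oo) xs -> box l u w ->
  penalty lam1 lam2 xs <=
    penalty lam1 lam2 w + dot (gradient f xs) (w - xs) + A / 2 * norm2 (w - xs) ^+ 2.
Proof.
move=> /eht_cluster_subseq[phi [x_xs xS_xs xP_xs]] wB.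
have A_gt0 : 0 < A by rewrite divr_gt0 ?exprn_gt0// addr_gt0// mulr_gt0.
set g := gradient f xs.
have z_cvg : x (phi j) + h *: z (phi j) @[j --> \oo] --> xs - A^-1 *: g.
  have -> : xs - A^-1 *: g =
      xs + A^-1 *: (h ^- 2 *: (xs - xs) - (beta / h) *: (g - g) - g).
    by rewrite !subrr !scaler0 subrr sub0r scalerN.
  have -> : (fun j => x (phi j) + h *: z (phi j)) = (fun j => x (phi j) + A^-1 *:
      (h ^- 2 *: (x (phi j) - x (phi j).-1) -
       (beta / h) *: (gradient f (x (phi j)) - gradient f (x (phi j).-1)) -
       gradient f (x (phi j)))).
    apply/funext => j; rewrite -eht_zE scalerA; congr (_ + _ *: _).
    rewrite /A; field; rewrite gt_eqF//= gt_eqF//.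
    by rewrite addr_gt0// mulr_gt0.
  have g_cvg := lipschitz_cvg_gradient f Lf _ _ f_lip x_xs.
  have gP_cvg := lipschitz_cvg_gradient f Lf _ _ f_lip xP_xs.
  apply: cvgD => //; apply: cvgZl_tmp; apply: cvgB => //; apply: cvgB.
    by apply: cvgZl_tmp; exact: cvgB.
  by apply: cvgZl_tmp; exact: cvgB.
have model_cvg (a : nat -> 'rV[R]_n) (b : 'rV[R]_n) (P : R) : a @ \oo --> b ->
    P + A / 2 * norm2 (a j - (x (phi j) + h *: z (phi j))) ^+ 2 @[j --> \oo] -->
    P + A / 2 * norm2 (b - (xs - A^-1 *: g)) ^+ 2.
  move=> ab; rewrite sqr_norm2.
  under eq_cvg do rewrite sqr_norm2.
  apply: cvgD; first exact: cvg_cst.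
  by apply: cvgM; [exact: cvg_cst|apply: cvg_dot; exact: cvgB].
have [r r0 r_sgn] := near_sign_refines xs.
have penalty_near : \forall j \near \oo,
    penalty lam1 lam2 xs <= penalty lam1 lam2 (x (phi j).+1).
  have := cvg_norm2B _ _ xS_xs; move/cvgr0Pnorm_lt => /(_ _ r0); apply: filterS => j.
  rewrite ger0_norm ?norm2_ge0// => /r_sgn /sign_refines_counts[pos_le neg_le].
  by rewrite lerD// ler_wpM2l ?ler_nat// ltW.
have : penalty lam1 lam2 xs + A / 2 * norm2 (xs - (xs - A^-1 *: g)) ^+ 2 <=
    penalty lam1 lam2 w + A / 2 * norm2 (w - (xs - A^-1 *: g)) ^+ 2.
  apply: (ler_cvg_to (model_cvg _ _ _ xS_xs) (model_cvg _ _ _ (cvg_cst w))).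
  apply: filterS penalty_near => j penalty_le.
  apply: le_trans (eht_step_min (phi j) w wB).
  by rewrite lerD2r.
have -> : xs - (xs - A^-1 *: g) = A^-1 *: g by rewrite subKr.
have -> : w - (xs - A^-1 *: g) = w - xs - (- A^-1 *: g).
  by rewrite scaleNr opprK opprB addrA addrAC.
have normE : norm2 (- A^-1 *: g) = norm2 (A^-1 *: g) by rewrite scaleNr norm2N.
rewrite (sqr_norm2B (w - xs) (- A^-1 *: g)) normE dotZr (dotC _ g).
have -> : 2 * (- A^-1 * dot g (w - xs)) = - (2 / A * dot g (w - xs)) by ring.
have : A / 2 * (2 / A * dot g (w - xs)) = dot g (w - xs).
  by field; rewrite gt_eqF.
lra.
Qed.

End Algorithm.

Theorem theorem4p3 (R : realType) (n : nat) (f : 'rV[R]_n -> R)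
    (Lf lam1 lam2 beta h gamma : R) (l u : 'I_n -> \bar R)
    (x : nat -> 'rV[R]_n)
    (f_convex : convex_function setT f)
    (f_diff : forall y : 'rV[R]_n, differentiable f y)
    (f_lip : lipschitz_gradient f Lf)
    (lam1_gt0 : 0 < lam1) (lam2_ge0 : 0 <= lam2)
    (l_le0_leu : forall i, (l i <= 0 <= u i)%E)
    (l_lt_u : forall i, (l i < u i)%E)
    (f_level : level_bounded_on (box l u) f)
    (beta_ge0 : 0 <= beta) (h_gt0 : 0 < h) (gamma_gt0 : 0 < gamma)
    (gamma_gt : h^-1 + (2 * beta + h) * Lf < gamma)
    (x_eht : eht_sequence f l u lam1 lam2 0 beta h gamma x) :
  ((exists2 M : R, 0 < M & forall k, norm2 (x k) <= M) /\
   (\sum_(0 <= k <oo) (norm2 (x k.+1 - x k) ^+ 2)%:E < +oo)%E) /\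
  (forall xs : 'rV[R]_n, cluster (x @ \oo) xs ->
     local_minimizer (box l u) (objective f lam1 lam2) xs).
Proof.
split; first split.
- exact: (eht_bounded f_diff f_lip lam1_gt0 lam2_ge0 beta_ge0 h_gt0 gamma_gt0
    gamma_gt x_eht f_level).
- exact: (eht_series_lty f_diff f_lip lam1_gt0 lam2_ge0 beta_ge0 h_gt0 gamma_gt0
    gamma_gt x_eht f_convex f_level).
move=> xs xs_cl.
have [phi [x_xs _ _]] := eht_cluster_subseq f_diff f_lip lam1_gt0 lam2_ge0
  beta_ge0 h_gt0 gamma_gt0 gamma_gt x_eht f_convex f_level _ xs_cl.
apply: (stationary_local_minimizer _ _ _ _ _ ((1 + h * gamma) / h ^+ 2 / 2)) => //.
  by apply: (box_closed _ _ _ _ _ x_xs) => j; exact: (eht_in_box h_gt0 x_eht).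
move=> w; exact: (eht_cluster_stationary f_diff f_lip lam1_gt0 lam2_ge0 beta_ge0
  h_gt0 gamma_gt0 gamma_gt x_eht f_convex f_level).
Qed.
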